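(* Let $m\ge2$ and consider a polynomial $P=\sum_{i=1}^ma_iX_iX_{m-i+1}$ in noncommuting variables with complex coefficients such that $|a_ia_{m-i+1}|=1$ for all $i$. Let $q\in(0,1]$ be such that $\sum_{i=1}^m|a_i|^2=q+q^{-1}$. Then the following relations hold in $\mathcal{T}_P$: $$fS_i=S_i\gamma(f)\quad(f\in c,\ 1\le i\le m),\qquad \sum_{i=1}^m S_iS_i^*=1-e_0,\qquad \sum_{i=1}^m a_iS_iS_{m-i+1}=0,$$ $$S_i^*S_j+a_i\bar a_j\,\phi\, S_{m-i+1}S_{m-j+1}^*=\delta_{ij}1\quad(1\le i,j\le m),$$ where $\phi=(\phi(n))_{n=0}^\infty\in c$ is defined by $\phi(n)=\dfrac{[n]_q}{[n+1]_q}$.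
   Context: Let $H=\mathbb{C}^m$ with its standard orthonormal basis, and identify the tensor algebra $T(H)$ with $\mathbb{C}\langle X_1,\dots,X_m\rangle$, so that the monomials $X_{i_1}\cdots X_{i_n}$ form an orthonormal basis of $H^{\otimes n}$. Let $I=\langle P\rangle$ be the two-sided ideal generated by $P$, $I_n\subset H^{\otimes n}$ its degree $n$ component, and $H_n=I_n^\perp\subset H^{\otimes n}$ (so $H_0=\mathbb{C}$, $H_1=H$). Let $f_n\colon H^{\otimes n}\to H_n$ be the orthogonal projection and $\mathcal{F}_P=\bigoplus_{n=0}^\infty H_n$ the Fock space. Define $S_i\in B(\mathcal{F}_P)$ by $S_i\zeta=f_{n+1}(X_i\zeta)$ for $\zeta\in H_n$. The Toeplitz algebra $\mathcal{T}_P$ is the unital C$^*$-algebra generated by $S_1,\dots,S_m$; it contains the compact operators on $\mathcal{F}_P$. The algebra $c=C(\mathbb{Z}_+\cup\{+\infty\})$ of converging sequences is viewed as a subalgebra of $\mathcal{T}_P$ by letting $f\in c$ act on $H_n$ as the scalar $f(n)$; $e_n\in c$ is the projection $\mathcal{F}_P\to H_n$; $\gamma$ is the shift to the left, $\gamma(f)(n)=f(n+1)$. Here $[k]_q=\frac{q^k-q^{-k}}{q-q^{-1}}$, with $[k]_1=k$. *)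

(* Defs.v *)
From HB Require Import structures.
From mathcomp Require Import all_boot all_order all_algebra.
From mathcomp Require Import complex ring lra.
From mathcomp Require Import all_classical all_reals all_analysis.

Set Implicit Arguments.
Unset Strict Implicit.
Unset Printing Implicit Defensive.

Import Order.TTheory GRing.Theory Num.Theory.
Import numFieldNormedType.Exports.

Local Open Scope classical_set_scope.
Local Open Scope ring_scope.

(* The word [:: i_1; ...; i_n] over 'I_m stands for the monomial
   X_{i_1} ... X_{i_n}; letters are numbered from 0, so that the letter
   m - i + 1 of the 1-based numbering is rev_ord i.
   A function x : seq 'I_m -> R[i] is the formal series \sum_w x(w) w.
   All spaces below are spaces of such functions:
     tensor_power n    H^{\otimes n}
     ideal_part P n    I_n
     fock_part P n     H_n
     fock_proj P n     f_n
     fock P            F_P, the Hilbert direct sum of the H_n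
     bop P             B(F_P)
     creation P i      S_i
     toeplitz P        T_P, as a subset of B(F_P)
     cseq R            c, and cseq_op P f is the operator given by f in c
     cseq_shift        gamma
     cseq_proj R n     e_n
     qint q k          [k]_q
     cseq_phi hq       phi *)
Section FreeAlgebra.
Variables (R : realType) (m : nat).
Implicit Types (x y z : seq 'I_m -> R[i]) (w : seq 'I_m).

Definition ncvar (i : 'I_m) : seq 'I_m -> R[i] := fun w => (w == [:: i])%:R.

(* The sum runs over all factorizations w = uv. *)
Definition ncmul x y : seq 'I_m -> R[i] :=
  fun w => \sum_(k < (size w).+1) x (take k w) * y (drop k w).

Definition ncpoly : set (seq 'I_m -> R[i]) :=
  [set x | finite_set [set w | x w != 0]].

Definition ncideal (P : seq 'I_m -> R[i]) : set (seq 'I_m -> R[i]) :=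
  [set x | exists s : seq ((seq 'I_m -> R[i]) * (seq 'I_m -> R[i])),
     (forall AB, AB \in s -> ncpoly AB.1 /\ ncpoly AB.2) /\
     x = \sum_(AB <- s) ncmul (ncmul AB.1 P) AB.2].

Definition tensor_power (n : nat) : set (seq 'I_m -> R[i]) :=
  [set x | forall w, size w != n -> x w = 0].

Definition degree_part (n : nat) x : seq 'I_m -> R[i] :=
  fun w => if size w == n then x w else 0.

(* The inner product of the degree n components of x and y; the monomials of
   degree n are orthonormal. *)
Definition dotn (n : nat) x y : R[i] :=
  \sum_(w : n.-tuple 'I_m) x w * (y w)^*.

Definition ideal_part (P : seq 'I_m -> R[i]) (n : nat) :
    set (seq 'I_m -> R[i]) :=
  ncideal P `&` tensor_power n.

Definition fock_part (P : seq 'I_m -> R[i]) (n : nat) :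
    set (seq 'I_m -> R[i]) :=
  [set x | tensor_power n x /\ forall y, ideal_part P n y -> dotn n x y = 0].

(* Well defined by fock_projP and fock_proj_uniq. *)
Definition fock_proj (P : seq 'I_m -> R[i]) (n : nat) x : seq 'I_m -> R[i] :=
  xget 0 [set y | fock_part P n y /\
                  forall z, fock_part P n z -> dotn n (x - y) z = 0].

Lemma dotnDl n x y z : dotn n (x + y) z = dotn n x z + dotn n y z.
Proof.
by rewrite /dotn -big_split; apply: eq_bigr => w _; rewrite fctE mulrDl.
Qed.

Lemma dotnZl n (a : R[i]) x z : dotn n (a *: x) z = a * dotn n x z.
Proof. by rewrite /dotn mulr_sumr; apply: eq_bigr => w _; rewrite mulrA. Qed.

Lemma dotnC n x y : dotn n y x = (dotn n x y)^*.
Proof.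
rewrite /dotn rmorph_sum; apply: eq_bigr => w _.
by rewrite rmorphM /= conjCK mulrC.
Qed.

Lemma dotn0l n z : dotn n 0 z = 0.
Proof. by rewrite /dotn big1 // => w _; rewrite mul0r. Qed.

Lemma dotnBl n x y z : dotn n (x - y) z = dotn n x z - dotn n y z.
Proof. by rewrite dotnDl -scaleN1r dotnZl mulN1r. Qed.

Lemma dotnDr n x y z : dotn n x (y + z) = dotn n x y + dotn n x z.
Proof. by rewrite dotnC dotnDl rmorphD /= -!dotnC. Qed.

Lemma dotnZr n (a : R[i]) x z : dotn n x (a *: z) = a^* * dotn n x z.
Proof. by rewrite dotnC dotnZl rmorphM /= -dotnC. Qed.

Lemma dotn_ge0 n x : 0 <= dotn n x x.
Proof. by apply: sumr_ge0 => w _; rewrite mul_conjC_ge0. Qed.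

Lemma dotn_eq0 n x : dotn n x x = 0 -> forall w, size w = n -> x w = 0.
Proof.
move=> x0 w sw; have := psumr_eq0P _ x0.
have ge0 (u : n.-tuple 'I_m) : true -> 0 <= x u * (x u)^*.
  by rewrite mul_conjC_ge0.
move=> /(_ ge0 (Tuple (introT eqP sw)) isT) /eqP.
by rewrite mul_conjC_eq0 => /eqP.
Qed.

Lemma fock_part_lin P n (a : R[i]) x y :
  fock_part P n x -> fock_part P n y -> fock_part P n (a *: x + y).
Proof.
move=> [x1 x2] [y1 y2]; split=> [w sw|z Iz].
  by rewrite !fctE x1 // y1 // scaler0 addr0.
by rewrite dotnDl dotnZl x2 // y2 // mulr0 addr0.
Qed.

Lemma fock_part0 P n : fock_part P n 0.
Proof. by split=> // z _; rewrite dotn0l. Qed.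

Lemma proj_exists n (s : seq (n.-tuple 'I_m)) (V : set (seq 'I_m -> R[i])) :
  V 0 -> (forall (a : R[i]) x y, V x -> V y -> V (a *: x + y)) ->
  (forall x, V x -> forall w, (forall t, t \in s -> w != tval t) -> x w = 0) ->
  forall x, exists y, V y /\ forall z, V z -> dotn n (x - y) z = 0.
Proof.
elim: s V => [|t s IHs] V V0 Vlin Vs x.
  exists 0; split=> // z Vz; suff -> : z = 0.
    by rewrite dotnC dotn0l rmorph0.
  by apply/funext => w; apply: Vs.
pose V' := V `&` [set y | y t = 0].
have V'lin (a : R[i]) y z : V' y -> V' z -> V' (a *: y + z).
  move=> [Vy yt] [Vz zt]; split; first exact: Vlin.
  by rewrite /= !fctE yt zt scaler0 addr0.
have V's y : V' y -> forall w, (forall u, u \in s -> w != tval u) -> y w = 0.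
  move=> [Vy yt] w ws; have [->|wt] := eqVneq w t; first exact: yt.
  apply: Vs => // u; rewrite inE => /orP[/eqP->//|us]; exact: ws.
have proj' := IHs V' (conj V0 erefl) V'lin V's.
have [[v [Vv vt]]|nov] := pselect (exists v, V v /\ v t != 0); last first.
  have [y [[Vy _] Hy]] := proj' x; exists y; split=> // z Vz; apply: Hy.
  by split=> //; apply: contrapT => zt; apply: nov; exists z; split=> //;
     apply/eqP.
have [p [[Vp pt] Hp]] := proj' v.
pose u := v - p.
have ut : u t = v t by rewrite /u !fctE pt subr0.
have Vu : V u by rewrite /u addrC -scaleN1r; apply: Vlin.
have uV' z : V' z -> dotn n u z = 0 by apply: Hp.
have uu : dotn n u u != 0.
  apply: contra_neq vt => /dotn_eq0/(_ t (size_tuple t)).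
  by rewrite ut.
have [y [V'y Hy]] := proj' x.
have [Vy _] := V'y.
exists ((dotn n x u / dotn n u u) *: u + y); split; first exact: Vlin.
move=> z Vz.
have -> : z = (z t / v t) *: u + (z - (z t / v t) *: u) by rewrite addrC subrK.
have V'z : V' (z - (z t / v t) *: u).
  split; first by rewrite addrC -scaleNr; apply: Vlin.
  rewrite /= !fctE ut; apply/eqP; rewrite subr_eq0; apply/eqP.
  by rewrite /GRing.scale /= divfK.
set k := dotn n x u / dotn n u u.
have -> : x - (k *: u + y) = x - y - k *: u by rewrite opprD addrCA addrC.
rewrite dotnDr dotnZr -scaleNr 2![dotn n (x - y + _) _]dotnDl !dotnZl.
rewrite (uV' _ V'z) (Hy _ V'z) mulr0 !addr0 dotnBl (dotnC n u y) uV' //.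
by rewrite rmorph0 subr0 mulNr divfK // subrr mulr0.
Qed.

Lemma fock_projP P n x : fock_part P n (fock_proj P n x) /\
  forall z, fock_part P n z -> dotn n (x - fock_proj P n x) z = 0.
Proof.
rewrite /fock_proj; case: xgetP => [y _ //|no].
have [|||y Hy] := @proj_exists n (enum {: n.-tuple 'I_m}) (fock_part P n) _ _ _ x.
- exact: fock_part0.
- exact: fock_part_lin.
- move=> y [y0 _] w nw; apply: y0; apply/negP => sw.
  by have := nw (Tuple sw); rewrite mem_enum inE /= eqxx => /(_ isT).
- by case: (no y).
Qed.

Lemma fock_proj_uniq P n x y : fock_part P n y ->
  (forall z, fock_part P n z -> dotn n (x - y) z = 0) -> fock_proj P n x = y.
Proof.
move=> Hy yP; have [Hf fP] := fock_projP P n x.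
set f := fock_proj P n x in Hf fP *.
have Hd : fock_part P n (y - f) by rewrite addrC -scaleN1r; apply: fock_part_lin.
have : dotn n (y - f) (y - f) = 0.
  have e : y - f = (x - f) - (x - y) by rewrite opprB [RHS]addrC addrA subrK.
  by rewrite {1}e dotnBl fP // yP // subr0.
move=> /dotn_eq0 d0; apply/esym/eqP; rewrite -subr_eq0; apply/eqP.
apply/funext => w; have [/d0//|nw] := eqVneq (size w) n.
by case: Hd => /(_ w nw).
Qed.

Lemma fock_proj_lin P n (a : R[i]) x y :
  fock_proj P n (a *: x + y) = a *: fock_proj P n x + fock_proj P n y.
Proof.
have [xH xP] := fock_projP P n x; have [yH yP] := fock_projP P n y.
apply: fock_proj_uniq; first exact: fock_part_lin.
move=> z Hz; rewrite dotnBl !dotnDl !dotnZl.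
have /subr0_eq -> : dotn n x z - dotn n (fock_proj P n x) z = 0.
  by rewrite -dotnBl xP.
have /subr0_eq -> : dotn n y z - dotn n (fock_proj P n y) z = 0.
  by rewrite -dotnBl yP.
by rewrite subrr.
Qed.

Lemma fock_proj_le P n x :
  dotn n (fock_proj P n x) (fock_proj P n x) <= dotn n x x.
Proof.
have [xH xP] := fock_projP P n x; set f := fock_proj P n x in xH xP *.
have -> : dotn n x x = dotn n (x - f + f) (x - f + f) by rewrite subrK.
rewrite dotnDl (dotnDr n _ _ f) (dotnDr n f _ f) (xP _ xH).
by rewrite (dotnC n (x - f) f) (xP _ xH) rmorph0 addr0 add0r lerDr dotn_ge0.
Qed.

Lemma ncmul_varl (i : 'I_m) x w :
  ncmul (ncvar i) x w = if w is j :: v then (j == i)%:R * x v else 0.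
Proof.
rewrite /ncmul /ncvar; case: w => [|j v]; first by rewrite big_ord1 mul0r.
rewrite big_ord_recl /= mul0r add0r big_ord_recl /= take0 drop0.
rewrite big1 ?addr0; last first.
  move=> k _; rewrite /bump; case: v k => [[]//|l v k] /=.
  by rewrite eqseq_cons andbF mul0r.
by rewrite eqseq_cons eqxx andbT.
Qed.

Lemma dotn_ncmul_var n (i : 'I_m) x y :
  dotn n.+1 (ncmul (ncvar i) x) (ncmul (ncvar i) y) = dotn n x y.
Proof.
rewrite /dotn (reindex (fun p : 'I_m * n.-tuple 'I_m => [tuple of p.1 :: p.2]));
  last first.
  exists (fun t : n.+1.-tuple 'I_m => (thead t, [tuple of behead t])).
    by move=> [j w] _; congr pair; apply: val_inj.
  by move=> t _; rewrite -tuple_eta.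
rewrite -(pair_bigA _ (fun j (w : n.-tuple _) =>
    ncmul (ncvar i) x (j :: w) * (ncmul (ncvar i) y (j :: w))^*)) /=.
rewrite (bigD1 i) //= [X in _ + X]big1 ?addr0; last first.
  by move=> j ji; apply: big1 => w _; rewrite ncmul_varl (negbTE ji) !mul0r.
by apply: eq_bigr => w _; rewrite !ncmul_varl eqxx !mul1r.
Qed.

End FreeAlgebra.

Section FockSpace.
Variables (R : realType) (m : nat).
Implicit Types x y : seq 'I_m -> R[i].

Definition normn2 (n : nat) x : R := complex.Re (dotn n x x).

Definition series_norm2 x : \bar R := (\sum_(0 <= n <oo) (normn2 n x)%:E)%E.

Lemma normn2_ge0 n x : 0 <= normn2 n x.
Proof. by have := dotn_ge0 n x; rewrite lecE => /andP[]. Qed.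

Lemma normn2E n x : dotn n x x = (normn2 n x)%:C%C.
Proof.
rewrite /normn2; have := dotn_ge0 n x.
by case: (dotn n x x) => a b; rewrite lecE /= => /andP[/eqP -> _].
Qed.

Lemma eq_dotn n x x' y y' : (forall w, size w = n -> x w = x' w) ->
  (forall w, size w = n -> y w = y' w) -> dotn n x y = dotn n x' y'.
Proof.
by move=> xx yy; apply: eq_bigr => w _; rewrite xx ?yy ?size_tuple.
Qed.

Lemma normn2D n x y : normn2 n (x + y) <= 2 * normn2 n x + 2 * normn2 n y.
Proof.
suff -> : 2 * normn2 n x + 2 * normn2 n y = normn2 n (x + y) + normn2 n (x - y).
  by rewrite lerDl normn2_ge0.
apply: (@complexI R); rewrite !rmorphD !rmorphM /= -!normn2E.
rewrite -scaleN1r !dotnDl !dotnDr !dotnZl !dotnZr rmorphN rmorph1 /=.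
by rewrite !rmorphD rmorph1 !mulN1r !mulrDl !mul1r; ring.
Qed.

Lemma normn2_scale n (u : seq 'I_m -> R[i]) x (M : R) :
  (forall w, size w = n -> `|u w| <= M%:C%C) ->
  normn2 n (fun w => u w * x w) <= M ^+ 2 * normn2 n x.
Proof.
move=> uM; rewrite -lecR rmorphM rmorphXn /= -!normn2E mulr_sumr.
apply: ler_sum => w _; rewrite -!normCK normrM exprMn ler_wpM2r ?exprn_ge0 //.
by rewrite lerXn2r ?nnegrE ?uM ?size_tuple // (le_trans _ (uM w _)) ?size_tuple.
Qed.

Lemma series_norm2_ge0 x : (0 <= series_norm2 x)%E.
Proof. by apply: nneseries_ge0 => n _ _; rewrite lee_fin normn2_ge0. Qed.

Lemma series_norm2_0 : series_norm2 0 = 0%E.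
Proof. by rewrite /series_norm2 eseries0 // => n _ _; rewrite /normn2 dotn0l. Qed.

Lemma series_norm2D x y :
  (series_norm2 (x + y)%R <= 2%:E * series_norm2 x + 2%:E * series_norm2 y)%E.
Proof.
rewrite -!nneseriesZl; last 2 first.
- by move=> n _; rewrite lee_fin normn2_ge0.
- by move=> n _; rewrite lee_fin normn2_ge0.
rewrite -nneseriesD; last 2 first.
- by move=> n _ _; rewrite -EFinM lee_fin mulr_ge0 ?normn2_ge0.
- by move=> n _ _; rewrite -EFinM lee_fin mulr_ge0 ?normn2_ge0.
apply: lee_nneseries => [n _ _|n _]; first by rewrite lee_fin normn2_ge0.
by rewrite -!EFinM -EFinD lee_fin normn2D.
Qed.

Lemma series_norm2_scale (u : seq 'I_m -> R[i]) x (M : R) :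
  (forall w, `|u w| <= M%:C%C) ->
  (series_norm2 (fun w => u w * x w)%R <= (M ^+ 2)%:E * series_norm2 x)%E.
Proof.
move=> uM; rewrite -nneseriesZl; last first.
  by move=> n _; rewrite lee_fin normn2_ge0.
apply: lee_nneseries => [n _ _|n _]; first by rewrite lee_fin normn2_ge0.
by rewrite -EFinM lee_fin; apply: normn2_scale => w _.
Qed.

Lemma Re_norm_ge0 (a : R[i]) : 0 <= complex.Re `|a|.
Proof. by have := normr_ge0 a; rewrite lecE => /andP[]. Qed.

Lemma normc_Re (a : R[i]) : (complex.Re `|a|)%:C%C = `|a|.
Proof.
have := normr_ge0 a; rewrite lecE; case: `|a| => b c /=.
by move=> /andP[/eqP -> _].
Qed.

Lemma series_norm2Z (a : R[i]) x :
  (series_norm2 (a *: x)%R <= (complex.Re `|a| ^+ 2)%:E * series_norm2 x)%E.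
Proof.
by apply: (@series_norm2_scale (fun=> a)) => w; rewrite normc_Re.
Qed.

Variable P : seq 'I_m -> R[i].

Definition fock_space : set (seq 'I_m -> R[i]) :=
  [set x | (forall n, fock_part P n (degree_part n x)) /\
           (series_norm2 x < +oo)%E].

Definition fock_pred : {pred seq 'I_m -> R[i]} := [pred x | `[< fock_space x >]].

Record fock : Type :=
  Fock { fock_val :> seq 'I_m -> R[i]; _ : fock_val \in fock_pred }.

HB.instance Definition _ := [isSub for fock_val].
HB.instance Definition _ := [Choice of fock by <:].

Lemma fock_submod_closed : submod_closed fock_pred.
Proof.
split=> [|a x y /asboolP[xP xn] /asboolP[yP yn]]; apply/asboolP.
  split=> [n|]; last by rewrite series_norm2_0 ltry.
  rewrite (_ : degree_part n 0 = 0); first exact: fock_part0.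
  by apply/funext => w; rewrite /degree_part if_same.
split=> [n|].
  rewrite (_ : degree_part n _ = a *: degree_part n x + degree_part n y).
    exact: fock_part_lin.
  apply/funext => w; rewrite !fctE /degree_part; case: ifP => //.
  by rewrite scaler0 addr0.
apply: (le_lt_trans (series_norm2D _ _)).
rewrite lte_add_pinfty // ltey_eq; apply/orP; left.
  apply: fin_numM => //; rewrite ge0_fin_numE ?series_norm2_ge0 //.
  apply: (le_lt_trans (series_norm2Z a x)).
  rewrite ltey_eq; apply/orP; left; apply: fin_numM => //.
  by rewrite ge0_fin_numE ?series_norm2_ge0.
by apply: fin_numM => //; rewrite ge0_fin_numE ?series_norm2_ge0.
Qed.

HB.instance Definition _ :=
  GRing.isSubmodClosed.Build R[i] (seq 'I_m -> R[i]) fock_pred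
    fock_submod_closed.
HB.instance Definition _ := [SubChoice_isSubLmodule of fock by <:].

Definition fock_inner (x y : fock) : R[i] :=
  limn (fun N => \sum_(n < N) dotn n x y : R[i]^o).

Definition fock_norm (x : fock) : R := Num.sqrt (fine (series_norm2 x)).

Lemma fock_norm_le (x : fock) (z : seq 'I_m -> R[i]) (M : R) : 0 <= M ->
  (series_norm2 x <= (M ^+ 2)%:E * series_norm2 z)%E ->
  (series_norm2 z < +oo)%E ->
  fock_norm x <= M * Num.sqrt (fine (series_norm2 z)).
Proof.
move=> M0 xz zoo; have zfin : series_norm2 z \is a fin_num.
  by rewrite ge0_fin_numE ?series_norm2_ge0.
have xfin : series_norm2 x \is a fin_num.
  rewrite ge0_fin_numE ?series_norm2_ge0 //; apply: (le_lt_trans xz).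
  by rewrite ltey_eq fin_numM.
rewrite -{1}(ger0_norm M0) -sqrtr_sqr -sqrtrM ?sqr_ge0 // ler_wsqrtr //.
by rewrite -lee_fin EFinM (fineK xfin) (fineK zfin).
Qed.

Lemma fock_norm_ge0 (x : fock) : 0 <= fock_norm x.
Proof. exact: sqrtr_ge0. Qed.

Lemma fock_valP (x : fock) : fock_space x.
Proof. by case: x => x /= /asboolP. Qed.

Lemma fock_norm_scale (a : R[i]) (x : fock) :
  fock_norm (a *: x) <= complex.Re `|a| * fock_norm x.
Proof.
have [_ xoo] := fock_valP x.
by apply: fock_norm_le; rewrite ?Re_norm_ge0 //; exact: series_norm2Z.
Qed.

Lemma fock_normD (x y : fock) :
  fock_norm (x + y) <= 2 * (fock_norm x + fock_norm y).
Proof.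
have [_ xoo] := fock_valP x; have [_ yoo] := fock_valP y.
have [_ xyoo] := fock_valP (x + y).
have fin (z : fock) : series_norm2 z = (fine (series_norm2 z))%:E.
  by rewrite fineK // ge0_fin_numE ?series_norm2_ge0 //; have [] := fock_valP z.
have sq (z : fock) : fock_norm z ^+ 2 = fine (series_norm2 z).
  by rewrite sqr_sqrtr // fine_ge0 ?series_norm2_ge0.
have := series_norm2D x y; rewrite (fin x) (fin y) (fin (x + y)) -!sq.
rewrite -!EFinM -EFinD lee_fin => le_xy.
rewrite -(@ler_pXn2r _ 2) ?nnegrE ?mulr_ge0 ?addr_ge0 ?fock_norm_ge0 //.
apply: (le_trans le_xy).
have := fock_norm_ge0 x; have := fock_norm_ge0 y.
by move: (fock_norm x) (fock_norm y) => a b; nra.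
Qed.

Definition bounded_linear (T : fock -> fock) : Prop :=
  linear T /\ exists M : R, forall x : fock, fock_norm (T x) <= M * fock_norm x.

Definition bop_pred : {pred fock -> fock} := [pred T | `[< bounded_linear T >]].

Record bop : Type := Bop { bop_fun :> fock -> fock; _ : bop_fun \in bop_pred }.

HB.instance Definition _ := [isSub for bop_fun].
HB.instance Definition _ := [Choice of bop by <:].

Lemma bopP (T : bop) : bounded_linear T.
Proof. by case: T => T /= /asboolP. Qed.

Lemma bounded_linear_gt0 (T : fock -> fock) : bounded_linear T ->
  exists2 M : R, 0 <= M & forall x : fock, fock_norm (T x) <= M * fock_norm x.
Proof.
move=> [_ [M TM]]; exists `|M| => // x; apply: (le_trans (TM x)).
by rewrite ler_wpM2r ?fock_norm_ge0 ?ler_norm.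
Qed.

Lemma bop_submod_closed : submod_closed bop_pred.
Proof.
split=> [|a T U /asboolP TP /asboolP UP]; apply/asboolP.
  have z (x : fock) : (0 : fock -> fock) x = 0 by [].
  split=> [b x y|]; first by rewrite !z scaler0 addr0.
  exists 0 => x; rewrite mul0r z /fock_norm.
  by rewrite (_ : fock_val 0 = 0) ?series_norm2_0 ?sqrtr0.
have [[Tl _] [Ul _]] := (TP, UP).
split=> [b x y|].
  rewrite !fctE Tl Ul !scalerDr !scalerA mulrC -!addrA; congr (_ + _).
  by rewrite addrCA.
have [M M0 TM] := bounded_linear_gt0 TP; have [N N0 UN] := bounded_linear_gt0 UP.
have a0 := Re_norm_ge0 a.
exists (2 * (complex.Re `|a| * M + N)) => x.
apply: (le_trans (fock_normD _ _)); rewrite -mulrA ler_wpM2l // mulrDl lerD //.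
by rewrite -mulrA (le_trans (fock_norm_scale _ _)) // ler_wpM2l.
Qed.

HB.instance Definition _ :=
  GRing.isSubmodClosed.Build R[i] (fock -> fock) bop_pred bop_submod_closed.
HB.instance Definition _ := [SubChoice_isSubLmodule of bop by <:].

Lemma bop_one_subproof : (idfun : fock -> fock) \in bop_pred.
Proof. by apply/asboolP; split=> //; exists 1 => x; rewrite mul1r. Qed.

Lemma bop_mul_subproof (T U : bop) : T \o U \in bop_pred.
Proof.
have [[Tl _] [Ul _]] := (bopP T, bopP U).
have [M M0 TM] := bounded_linear_gt0 (bopP T).
have [N N0 UN] := bounded_linear_gt0 (bopP U).
apply/asboolP; split=> [b x y|]; first by rewrite /= Ul Tl.
exists (M * N) => x /=; apply: (le_trans (TM _)).
by rewrite -mulrA ler_wpM2l.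
Qed.

Definition bop_one : bop := Bop bop_one_subproof.
Definition bop_mul (T U : bop) : bop := Bop (bop_mul_subproof T U).

Lemma bopE (T U : bop) : (forall x : fock, T x = U x) -> T = U.
Proof. by move=> TU; apply: val_inj; apply/funext. Qed.

Lemma bop_mulA : associative bop_mul.
Proof. by move=> T U V; apply: bopE. Qed.
Lemma bop_mul1r : left_id bop_one bop_mul.
Proof. by move=> T; apply: bopE. Qed.
Lemma bop_mulr1 : right_id bop_one bop_mul.
Proof. by move=> T; apply: bopE. Qed.
Lemma bop_mulDl : left_distributive bop_mul +%R.
Proof. by move=> T U V; apply: bopE. Qed.
Lemma bop_mulDr : right_distributive bop_mul +%R.
Proof.
move=> T U V; apply: bopE => x /=; have [Tl _] := bopP T.
by have := Tl 1 (U x) (V x); rewrite !scale1r.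
Qed.

HB.instance Definition _ := GRing.Zmodule_isPzRing.Build bop
  bop_mulA bop_mul1r bop_mulr1 bop_mulDl bop_mulDr.

(* The adjoint, which exists and is unique by the Riesz representation theorem. *)
Definition adjoint (T : bop) : bop :=
  xget 0 [set T' : bop | forall x y : fock, fock_inner (T x) y = fock_inner x (T' y)].

Definition op_norm (T : bop) : R :=
  inf [set M | 0 <= M /\ forall x : fock, fock_norm (T x) <= M * fock_norm x].

Definition unital_Cstar_subalgebra (A : set bop) : Prop :=
  [/\ A 1,
      forall (a : R[i]) T U, A T -> A U -> A (a *: T + U),
      forall T U, A T -> A U -> A (T * U),
      forall T, A T -> A (adjoint T) &
      forall T, (forall e : R, 0 < e -> exists2 U, A U & op_norm (T - U) < e) ->
        A T].

(* The component of degree n + 1 of S_i x is f_{n+1}(X_i x_n), where x_n is the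
   component of x in H_n; the component of degree 0 is zero. *)
Definition creation_fun (i : 'I_m) x : seq 'I_m -> R[i] :=
  fun w => if size w is n.+1
    then fock_proj P n.+1 (ncmul (ncvar R i) (degree_part n x)) w else 0.

Lemma degree_part_creation0 i x : degree_part 0 (creation_fun i x) = 0.
Proof. by apply/funext => -[|j w]; rewrite /degree_part. Qed.

Lemma degree_part_creation i x n : degree_part n.+1 (creation_fun i x) =
  fock_proj P n.+1 (ncmul (ncvar R i) (degree_part n x)).
Proof.
apply/funext => w; rewrite /degree_part /creation_fun.
have [->//|nw] := eqVneq (size w) n.+1.
have [[h _] _] := fock_projP P n.+1 (ncmul (ncvar R i) (degree_part n x)).
by rewrite h.
Qed.

Lemma normn2_degree_part n x : normn2 n (degree_part n x) = normn2 n x.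
Proof.
by congr (complex.Re _); apply: eq_dotn => w sw; rewrite /degree_part sw eqxx.
Qed.

Lemma normn2_creation i x n : normn2 n.+1 (creation_fun i x) <= normn2 n x.
Proof.
rewrite -normn2_degree_part degree_part_creation -(normn2_degree_part n x).
rewrite -lecR -!normn2E (le_trans (fock_proj_le _ _ _)) //.
by rewrite dotn_ncmul_var.
Qed.

Lemma series_norm2_creation i x :
  (series_norm2 (creation_fun i x) <= series_norm2 x)%E.
Proof.
rewrite /series_norm2 nneseries_recl //; last first.
  by move=> n _; rewrite lee_fin normn2_ge0.
rewrite -[normn2 0 _]normn2_degree_part degree_part_creation0.
rewrite {1}/normn2 dotn0l add0e.
rewrite -(@nneseries_addn _ (fun n => (normn2 n (creation_fun i x))%:E) 1); last first.
  by move=> n; rewrite lee_fin normn2_ge0.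
apply: lee_nneseries => [n _ _|n _]; first by rewrite lee_fin normn2_ge0.
by rewrite lee_fin addn1 normn2_creation.
Qed.

Lemma creation_fock i (x : fock) : creation_fun i x \in fock_pred.
Proof.
have [xP xoo] := fock_valP x; apply/asboolP; split=> [[|n]|].
- by rewrite degree_part_creation0; exact: fock_part0.
- by rewrite degree_part_creation; have [] := fock_projP P n.+1
    (ncmul (ncvar R i) (degree_part n x)).
- exact: le_lt_trans (series_norm2_creation i x) xoo.
Qed.

Lemma ncmul_varl_lin i n (a : R[i]) x y :
  ncmul (ncvar R i) (degree_part n (a *: x + y)) =
  a *: ncmul (ncvar R i) (degree_part n x) + ncmul (ncvar R i) (degree_part n y).
Proof.
apply/funext => w; rewrite !fctE !ncmul_varl.
case: w => [|j w]; first by rewrite scaler0 addr0.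
rewrite /degree_part; case: ifP => _; last by rewrite !mulr0 scaler0 addr0.
by rewrite mulrDr /GRing.scale /= mulrCA.
Qed.

Lemma creation_fun_lin i (a : R[i]) x y :
  creation_fun i (a *: x + y) = a *: creation_fun i x + creation_fun i y.
Proof.
apply/funext => w; rewrite !fctE /creation_fun.
case: (size w) => [|n]; first by rewrite scaler0 addr0.
by rewrite ncmul_varl_lin fock_proj_lin.
Qed.

Lemma creation_bounded i :
  (fun x : fock => Fock (creation_fock i x)) \in bop_pred.
Proof.
apply/asboolP; split=> [a x y|].
  by apply: val_inj; exact: creation_fun_lin.
exists 1 => x; have [_ xoo] := fock_valP x.
apply: fock_norm_le => //; rewrite expr1n mul1e; exact: series_norm2_creation.
Qed.

Definition creation (i : 'I_m) : bop := Bop (creation_bounded i).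

Definition toeplitz : set bop :=
  smallest unital_Cstar_subalgebra (range creation).

End FockSpace.
Arguments creation {R m} P i.
Arguments toeplitz {R m} P _.

Section ConvergentSequences.
Variable R : realType.

(* The topology of the complex numbers is attached to the alias R[i]^o. *)
Record cseq : Type := CSeq {
  cseq_fun :> nat -> R[i];
  cseqP : cvgn (cseq_fun : nat -> R[i]^o) }.
Arguments cseqP : clear implicits.

Lemma cseq_shift_subproof (f : cseq) : cvgn ((fun n => f n.+1) : nat -> R[i]^o).
Proof.
have /cvg_ex[l fl] := cseqP f; apply/cvg_ex; exists l.
by rewrite (cvg_shiftS (cseq_fun f : nat -> R[i]^o)).
Qed.

Definition cseq_shift (f : cseq) : cseq := CSeq (@cseq_shift_subproof f).

Lemma cseq_proj_subproof n : cvgn ((fun k => (k == n)%:R) : nat -> R[i]^o).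
Proof.
apply/cvg_ex; exists 0; rewrite -(cvg_shiftn n.+1).
rewrite (_ : (fun _ => _) = cst 0); first exact: cvg_cst.
by apply/funext => k; rewrite gtn_eqF // addnS ltnS leq_addl.
Qed.

Definition cseq_proj (n : nat) : cseq := CSeq (@cseq_proj_subproof n).

Definition qint (q : R) (k : nat) : R :=
  if q == 1 then k%:R else (q ^+ k - q ^- k) / (q - q^-1).

Lemma cvg_real_complex (u : nat -> R) :
  cvgn u -> cvgn ((fun n => (u n)%:C%C) : nat -> R[i]^o).
Proof.
move=> /cvg_ex[l ul]; apply/cvg_ex; exists (l%:C%C : R[i]^o).
apply/cvgrPdist_lt => -[e e'] /=; rewrite ltcE /= => /andP[/eqP -> e0].
move/cvgrPdist_lt : ul => /(_ _ e0); apply: filterS => n.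
by rewrite -rmorphB /= normc_def /= expr0n addr0 sqrtr_sqr ltcR.
Qed.

Lemma cseq_phi_subproof (q : R) : 0 < q <= 1 ->
  cvgn ((fun n => (qint q n / qint q n.+1)%:C%C) : nat -> R[i]^o).
Proof.
move=> /andP[q0 q1]; apply: cvg_real_complex; rewrite /qint.
have [_|qn1] := eqVneq q 1.
  rewrite (_ : (fun _ => _) = (fun n => 1 - harmonic n)).
    by apply: is_cvgB; [exact: is_cvg_cst|apply/cvg_ex; exists 0; exact: cvg_harmonic].
  apply/funext => n; rewrite /harmonic /=.
  have n0 : n.+1%:R != 0 :> R by rewrite pnatr_eq0.
  by apply: (mulIf n0); rewrite divfK // mulrBl mulVf // mul1r -natr1 addrK.
have ql : q < 1 by rewrite lt_neqAle qn1.
have q20 : 0 <= q ^+ 2 by rewrite sqr_ge0.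
have q2l : q ^+ 2 < 1 by rewrite expr_lt1 // ltW.
have z0 : (fun n => (q ^+ 2) ^+ n) @ \oo --> (0 : R).
  by apply: cvg_expr; rewrite ger0_norm.
rewrite (_ : (fun _ => _) =
  (fun n => q * (1 - (q ^+ 2) ^+ n) * (1 - q ^+ 2 * (q ^+ 2) ^+ n)^-1)).
  apply: is_cvgM.
    apply: is_cvgM; first exact: is_cvg_cst.
    by apply: is_cvgB; [exact: is_cvg_cst|apply/cvg_ex; exists 0].
  apply/cvg_ex; exists (1 - q ^+ 2 * 0)^-1.
  apply: cvgV; first by rewrite mulr0 subr0 oner_neq0.
  by apply: cvgB; [exact: cvg_cst|apply: cvgM; [exact: cvg_cst|]].
apply/funext => n.
have qx : q != 0 by rewrite gt_eqF.
have qn0 : q ^+ n != 0 by rewrite expf_neq0.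
have lt1 : q * q ^+ n < 1 by rewrite -exprS exprn_ilt1 // ltW.
have d1 : 1 - q ^+ 2 * (q ^+ n) ^+ 2 != 0.
  by rewrite gt_eqF // subr_gt0 -exprMn expr_lt1 ?mulr_ge0 ?exprn_ge0 // ltW.
have d2 : q ^+ 2 - 1 != 0 by rewrite lt_eqF // subr_lt0.
rewrite -exprM mulnC exprM !exprS; field.
rewrite qx qn0 -(expr2 q) d2 -!mulrA (mulrCA (q ^+ n) q) !mulrA -expr2.
by rewrite -mulrA -expr2 d1 -opprB oppr_eq0 d1.
Qed.

Definition cseq_phi (q : R) (hq : 0 < q <= 1) : cseq :=
  CSeq (@cseq_phi_subproof q hq).

Variables (m : nat) (P : seq 'I_m -> R[i]).

Lemma cseq_bounded (f : cseq) :
  exists2 M : R, 0 <= M & forall n, `|f n| <= M%:C%C.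
Proof.
have [M [Mr HM]] := cvg_seq_bounded (cseqP f).
pose K := `|complex.Re M| + 1.
have MK : M < K%:C%C.
  move: Mr; rewrite realE !lecE /K; case: (M) => a b /=; rewrite ltcE /=.
  rewrite [b == 0]eq_sym => /orP[]/andP[/eqP <- _]; rewrite eqxx /=.
    by rewrite ltr_pwDr // ler_norm.
  by rewrite ltr_pwDr // ler_norm.
by exists K => [|n]; [rewrite addr_ge0|exact: (HM _ MK n I)].
Qed.

Lemma cseq_op_bound (f : cseq) : exists2 M : R, 0 <= M &
  forall x : seq 'I_m -> R[i],
  (series_norm2 (fun w => f (size w) * x w)%R <= (M ^+ 2)%:E * series_norm2 x)%E.
Proof.
have [M M0 fM] := cseq_bounded f; exists M => // x.
by apply: (@series_norm2_scale _ _ (fun w => f (size w))) => w.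
Qed.

Lemma cseq_op_fock (f : cseq) (x : fock P) :
  (fun w => f (size w) * x w) \in fock_pred P.
Proof.
have [xP xoo] := fock_valP x; apply/asboolP; split=> [n|].
  rewrite (_ : degree_part n _ = f n *: degree_part n x + 0).
    by apply: fock_part_lin => //; exact: fock_part0.
  apply/funext => w; rewrite addr0 !fctE /degree_part.
  by case: eqP => [->//|_]; rewrite scaler0.
have [M M0 fM] := cseq_op_bound f.
apply: (le_lt_trans (fM x)); rewrite ltey_eq fin_numM //.
by rewrite ge0_fin_numE ?series_norm2_ge0.
Qed.

Lemma cseq_op_bounded (f : cseq) :
  (fun x : fock P => Fock (cseq_op_fock f x)) \in @bop_pred R m P.
Proof.
apply/asboolP; split=> [a x y|].
  apply: val_inj; apply/funext => w; rewrite /= !fctE /=.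
  by rewrite mulrDr /GRing.scale /= mulrCA.
have [M M0 fM] := cseq_op_bound f; exists M => x.
by have [_ xoo] := fock_valP x; apply: fock_norm_le => //; exact: fM.
Qed.

Definition cseq_op (f : cseq) : bop P := Bop (cseq_op_bounded f).

End ConvergentSequences.
Arguments cseq_op {R m} P f.

Section Quadratic.
Variables (R : realType) (m : nat).

Definition quadratic (a : 'I_m -> R[i]) : seq 'I_m -> R[i] :=
  \sum_(i < m) a i *: ncmul (ncvar R i) (ncvar R (rev_ord i)).

End Quadratic.

(* Main.v *)
(* On H_{n+1} the adjoint of S_i strips a leading letter i from every word, and
   H_n consists of the x in H^{\otimes n} on which all contractions against P
   vanish. Everything but the last relation follows by testing against vectors
   of H_n. The last relation on H_n is proved by induction on n: it prescribes
   S_i^* S_j x for all i, hence a candidate T_j x = \sum_i X_i (...) for S_j x.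
   X_j x - T_j x is orthogonal to H_{n+1}, and T_j x lies in H_{n+1} because its
   only possibly nonzero contraction, at the first two letters, is by induction
   a multiple of 1 - phi(n) (q + q^-1 - phi(n-1)) = 0.
   For the inclusion of c in T_P, note e_{n+1} = \sum_i S_i e_n S_i^*. *)
Require Import Defs.
From mathcomp Require Import all_boot all_order all_algebra.
From mathcomp Require Import complex ring.
From mathcomp Require Import all_classical all_reals all_analysis.

Import Order.TTheory GRing.Theory Num.Theory.
Import numFieldNormedType.Exports.
Local Open Scope ring_scope.

Set Implicit Arguments.
Unset Strict Implicit.
Unset Printing Implicit Defensive.

(** * Stripping the leading letter; formal series by degree *)

Section Annihilation.
Variables (R : realType) (m : nat).
Implicit Types (A B x y z : seq 'I_m -> R[i]) (u v w : seq 'I_m).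

Definition annih (i : 'I_m) x : seq 'I_m -> R[i] := fun w => x (i :: w).

(** A twisted Leibniz rule: a factorization of [i :: w] has either an empty left factor or one
    beginning with [i]. *)
Lemma annih_ncmul i A B :
  annih i (ncmul A B) = A [::] *: annih i B + ncmul (annih i A) B.
Proof.
apply/funext => w; rewrite !fctE /annih /ncmul /= big_ord_recl /=; congr (_ + _).
Qed.

Lemma annih_ncmul_var i j x :
  annih i (ncmul (ncvar R j) x) = (i == j)%:R *: x.
Proof. by apply/funext => w; rewrite /annih ncmul_varl !fctE. Qed.

Lemma annih_tensor_power i n x :
  tensor_power n.+1 x -> tensor_power n (annih i x).
Proof. by move=> xn w wn; apply: xn; rewrite /= eqSS. Qed.

Lemma annih_tensor_power0 i x : tensor_power 0 x -> annih i x = 0.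
Proof. by move=> x0; apply/funext => w; apply: x0. Qed.

Lemma tensor_power_ncmul p n x y :
  tensor_power p x -> tensor_power n y -> tensor_power (p + n) (ncmul x y).
Proof.
move=> xp yn w wn; apply: big1 => k _.
have kw : (k <= size w)%N by rewrite -ltnS.
have [kp|kp] := eqVneq (k : nat) p; last first.
  by rewrite xp ?mul0r // size_take_min (minn_idPl kw).
rewrite yn ?mulr0 // size_drop; apply: contra_neq wn => <-.
by rewrite -kp subnKC.
Qed.

(** Orthogonal decomposition of the tensor power by the first letter; it carries the inductions on
    degree. *)
Lemma dotn_annih n x y :
  dotn n.+1 x y = \sum_(i < m) dotn n (annih i x) (annih i y).
Proof.
rewrite /dotn (reindex (fun p : 'I_m * n.-tuple 'I_m => [tuple of p.1 :: p.2])).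
  by rewrite -(pair_bigA _ (fun j (w : n.-tuple _) => x (j :: w) * (y (j :: w))^*)).
exists (fun t : n.+1.-tuple 'I_m => (thead t, [tuple of behead t])).
  by move=> [j w] _; congr pair; apply: val_inj.
by move=> t _; rewrite -tuple_eta.
Qed.

Lemma dotn0r n x : dotn n x 0 = 0.
Proof. by rewrite dotnC dotn0l rmorph0. Qed.

Lemma dotn_suml n (I : Type) (r : seq I) (F : I -> seq 'I_m -> R[i]) y :
  dotn n (\sum_(i <- r) F i) y = \sum_(i <- r) dotn n (F i) y.
Proof.
by apply: (big_morph (fun x => dotn n x y)) => [x z|];
  rewrite ?dotnDl ?dotn0l.
Qed.

Lemma dotn_sumr n (I : Type) (r : seq I) (F : I -> seq 'I_m -> R[i]) y :
  dotn n y (\sum_(i <- r) F i) = \sum_(i <- r) dotn n y (F i).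
Proof.
by apply: (big_morph (dotn n y)) => [x z|]; rewrite ?dotnDr ?dotn0r.
Qed.

Lemma dotn_degree_partl n x y : dotn n (degree_part n x) y = dotn n x y.
Proof. by apply: eq_dotn => w sw //; rewrite /degree_part sw eqxx. Qed.

Lemma degree_part_id n x : tensor_power n x -> degree_part n x = x.
Proof.
move=> xn; apply/funext => w; rewrite /degree_part.
by case: eqVneq => // /xn.
Qed.

Lemma degree_part_neq k n x : k != n -> tensor_power n x -> degree_part k x = 0.
Proof.
move=> kn xn; apply/funext => w; rewrite /degree_part.
by case: eqP => // wk; apply: xn; rewrite wk.
Qed.

Lemma tensor_power_degree_part n x : tensor_power n (degree_part n x).
Proof. by move=> w /negbTE; rewrite /degree_part => ->. Qed.

Lemma degree_partD n x y :
  degree_part n (x + y) = degree_part n x + degree_part n y.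
Proof.
by apply/funext => w; rewrite /degree_part !fctE; case: ifP; rewrite ?addr0.
Qed.

Lemma degree_partZ n (c : R[i]) x : degree_part n (c *: x) = c *: degree_part n x.
Proof.
by apply/funext => w; rewrite /degree_part !fctE; case: ifP; rewrite ?scaler0.
Qed.

Lemma degree_part_annih n i x :
  degree_part n (annih i x) = annih i (degree_part n.+1 x).
Proof. by apply/funext => w; rewrite /degree_part /annih /= eqSS. Qed.

Lemma degree_part_ext x y :
  (forall n, degree_part n x = degree_part n y) -> x = y.
Proof.
move=> xy; apply/funext => w; have := congr1 (fun z => z w) (xy (size w)).
by rewrite /degree_part eqxx.
Qed.

Lemma degree_part_sum n (I : Type) (r : seq I) (F : I -> seq 'I_m -> R[i]) :
  degree_part n (\sum_(i <- r) F i) = \sum_(i <- r) degree_part n (F i).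
Proof.
apply: (big_morph (degree_part n)) => [x y|]; first exact: degree_partD.
by apply/funext => w; rewrite /degree_part if_same.
Qed.

Definition monomial u : seq 'I_m -> R[i] := fun w => (w == u)%:R.

Lemma ncpoly_monomial u : ncpoly (monomial u).
Proof.
apply: (sub_finite_set (B := [set u]%classic)) => // w /=.
by rewrite /monomial; case: (w =P u) => //= _; rewrite eqxx.
Qed.

Lemma tensor_power_monomial u : tensor_power (size u) (monomial u).
Proof. by move=> w; rewrite /monomial; case: (w =P u) => // ->; rewrite eqxx. Qed.

Lemma annih_monomial i j u :
  annih i (monomial (j :: u)) = (i == j)%:R *: monomial u.
Proof.
apply/funext => w; rewrite /annih /monomial fctE eqseq_cons.
by case: eqP => _; rewrite ?scale1r ?scale0r.
Qed.

Lemma dotn_monomial n x v : size v = n -> dotn n x (monomial v) = x v.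
Proof.
move=> sv; rewrite /dotn (bigD1 (Tuple (introT eqP sv))) //= /monomial eqxx.
rewrite rmorph1 mulr1 big1 ?addr0 // => w wv.
by rewrite (negbTE (_ : tval w != v)) ?rmorph0 ?mulr0.
Qed.

Lemma ncmulZl (c : R[i]) A B : ncmul (c *: A) B = c *: ncmul A B.
Proof.
apply/funext => w; rewrite -[RHS]/(c * ncmul A B w) /ncmul mulr_sumr.
by apply: eq_bigr => k _; rewrite mulrA.
Qed.

Lemma ncmulDl A A' B : ncmul (A + A') B = ncmul A B + ncmul A' B.
Proof.
apply/funext => w; rewrite -[RHS]/(ncmul A B w + ncmul A' B w) /ncmul -big_split.
by apply: eq_bigr => k _; rewrite mulrDl.
Qed.

Lemma ncmul0l A : ncmul 0 A = 0.
Proof. by apply/funext => w; rewrite /ncmul big1 // => k _; rewrite mul0r. Qed.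

Lemma ncmul_monomial0 A : ncmul (monomial [::]) A = A.
Proof.
apply/funext => w; rewrite /ncmul big_ord_recl /= take0 drop0 /monomial eqxx mul1r.
rewrite big1 ?addr0 // => k _.
case: w k => [[]//|i w] k.
by rewrite /bump /= mul0r.
Qed.

Lemma normn2_annih n i (x : seq 'I_m -> R[i]) :
  normn2 n (annih i x) <= normn2 n.+1 x.
Proof.
rewrite -lecR -!normn2E dotn_annih (bigD1 i) //= lerDl.
by apply: sumr_ge0 => j _; apply: dotn_ge0.
Qed.

Lemma series_norm2_annih i (x : seq 'I_m -> R[i]) :
  (series_norm2 (annih i x) <= series_norm2 x)%E.
Proof.
rewrite /series_norm2 [leRHS]nneseries_recl //; last first.
  by move=> n _; rewrite lee_fin normn2_ge0.
rewrite -(@nneseries_addn _ (fun n => (normn2 n x)%:E) 1); last first.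
  by move=> n; rewrite lee_fin normn2_ge0.
apply: (@le_trans _ _ (\sum_(0 <= n <oo) (normn2 (n + 1) x)%:E)%E).
  apply: lee_nneseries => [n _ _|n _]; first by rewrite lee_fin normn2_ge0.
  by rewrite lee_fin addn1 normn2_annih.
by rewrite leeDr // lee_fin normn2_ge0.
Qed.

End Annihilation.

(** * The spaces H_n and the creation maps for arbitrary P *)

Section FockPart.
Variables (R : realType) (m : nat) (P : seq 'I_m -> R[i]).
Implicit Types (x y z : seq 'I_m -> R[i]) (w : seq 'I_m).
Local Notation C := (creation_fun P).

(** The difference lies in H_n and is orthogonal to H_n, hence to itself. *)
Lemma fock_part_ext n x y : fock_part P n x -> fock_part P n y ->
  (forall z, fock_part P n z -> dotn n x z = dotn n y z) -> x = y.
Proof.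
move=> Hx Hy xy; pose d := x - y.
have Hd : fock_part P n d.
  by rewrite /d addrC -scaleN1r; apply: fock_part_lin.
have d0 : dotn n d d = 0 by rewrite {1}/d dotnBl xy // subrr.
apply/subr0_eq/funext => w; have [/(dotn_eq0 d0)//|nw] := eqVneq (size w) n.
by case: Hd => /(_ w nw).
Qed.

Lemma fock_partZ n (c : R[i]) x : fock_part P n x -> fock_part P n (c *: x).
Proof.
by move=> Hx; rewrite -[c *: x]addr0; apply: fock_part_lin => //; apply: fock_part0.
Qed.

Lemma fock_partD n x y :
  fock_part P n x -> fock_part P n y -> fock_part P n (x + y).
Proof. by move=> Hx; rewrite -[x]scale1r; apply: fock_part_lin. Qed.

Lemma fock_part_sum n (I : Type) (r : seq I) (F : I -> seq 'I_m -> R[i]) :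
  (forall i, fock_part P n (F i)) -> fock_part P n (\sum_(i <- r) F i).
Proof.
move=> HF; elim/big_ind: _ => // [|x y]; [exact: fock_part0|exact: fock_partD].
Qed.

Lemma fock_part_tensor n x : fock_part P n x -> tensor_power n x.
Proof. by case. Qed.

Lemma creation_fun_tensor n i x : tensor_power n x ->
  C i x = fock_proj P n.+1 (ncmul (ncvar R i) x).
Proof.
move=> xn; apply: degree_part_ext => -[|k].
  rewrite degree_part_creation0 (@degree_part_neq _ _ 0 n.+1) //.
  by apply: fock_part_tensor; have [] := fock_projP P n.+1 (ncmul (ncvar R i) x).
have [Hp _] := fock_projP P n.+1 (ncmul (ncvar R i) x).
rewrite degree_part_creation; have [->|kn] := eqVneq k n.
  by rewrite (degree_part_id xn) (degree_part_id Hp.1).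
rewrite (degree_part_neq kn xn) (degree_part_neq _ Hp.1) ?eqSS //.
have -> : ncmul (ncvar R i) 0 = 0.
  by apply/funext => -[|j w]; rewrite ncmul_varl ?mulr0.
by apply: fock_proj_uniq; [exact: fock_part0|move=> z _; rewrite subr0 dotn0l].
Qed.

Lemma degree_part_creationS i x n :
  degree_part n.+1 (C i x) = C i (degree_part n x).
Proof.
rewrite degree_part_creation -creation_fun_tensor //.
exact: tensor_power_degree_part.
Qed.

Lemma fock_part_creation n i x : tensor_power n x -> fock_part P n.+1 (C i x).
Proof.
move=> xn; rewrite (creation_fun_tensor i xn).
by have [] := fock_projP P n.+1 (ncmul (ncvar R i) x).
Qed.

Lemma creation_fun0 i : C i 0 = 0.
Proof.
have := creation_fun_lin P i (-1) 0 0.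
by rewrite scaler0 addr0 scaleN1r addNr.
Qed.

Lemma creation_funZ i (c : R[i]) (x : seq 'I_m -> R[i]) : C i (c *: x) = c *: C i x.
Proof. by rewrite -[c *: x]addr0 creation_fun_lin creation_fun0 addr0. Qed.

End FockPart.

(** * Description of H_n by contractions against the quadratic P *)

Section QuadraticRelation.
Variables (R : realType) (m : nat) (a : 'I_m -> R[i]).
Implicit Types (A B x y z : seq 'I_m -> R[i]) (u v w : seq 'I_m).
Local Notation P := (quadratic a).

Lemma quadratic0 : P [::] = 0.
Proof.
rewrite /quadratic fct_sumE big1 // => i _.
by rewrite !fctE ncmul_varl scaler0.
Qed.

Lemma annih_quadratic i : annih i P = a i *: ncvar R (rev_ord i).
Proof.
apply/funext => w; rewrite /annih /quadratic fct_sumE (bigD1 i) //= big1.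
  by rewrite addr0 !fctE ncmul_varl eqxx mul1r.
by move=> j ji; rewrite !fctE ncmul_varl eq_sym (negbTE ji) mul0r scaler0.
Qed.

Lemma tensor_power_quadratic : tensor_power 2 P.
Proof.
move=> [|i w] sw; first exact: quadratic0.
rewrite -[LHS]/(annih i P w) annih_quadratic fctE /ncvar.
by case: (w =P [:: rev_ord i]) sw => [->|_ _] //; rewrite scaler0.
Qed.

(** The adjoint of left multiplication by P. *)
Definition quad_contract x : seq 'I_m -> R[i] :=
  fun v => \sum_(i < m) (a i)^* * x (i :: rev_ord i :: v).

(** Two letters are stripped in turn: [annih i P] is a multiple of a single variable, so one term of
    each inner sum survives. *)
Lemma dotn_quad_contract n x B :
  dotn n.+2 x (ncmul P B) = dotn n (quad_contract x) B.
Proof.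
have -> : quad_contract x = \sum_(i < m) (a i)^* *: annih (rev_ord i) (annih i x).
  by apply/funext => v; rewrite fct_sumE.
rewrite dotn_annih dotn_suml; apply: eq_bigr => i _.
rewrite annih_ncmul quadratic0 scale0r add0r annih_quadratic ncmulZl.
rewrite dotnZr dotnZl; congr (_ * _).
rewrite dotn_annih (bigD1 (rev_ord i)) //= big1 ?addr0.
  by rewrite annih_ncmul_var eqxx scale1r.
by move=> j ji; rewrite annih_ncmul_var (negbTE ji) scale0r dotn0r.
Qed.

(** The prefix [u] places the contracted pair at any position. No degree is fixed, so the condition
    passes to [annih i x]. *)
Definition contraction_free x :=
  forall u v, \sum_(i < m) (a i)^* * x (u ++ i :: rev_ord i :: v) = 0.

Lemma contraction_free_annih x : contraction_free x <->
  (forall i, contraction_free (annih i x)) /\ quad_contract x = 0.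
Proof.
split=> [cx|[cx c0] [|j u] v]; last exact: cx.
- split=> [j u v|]; first exact: (cx (j :: u)).
  by apply/funext => v; apply: (cx [::]).
- by rewrite -[LHS]/(quad_contract x v) c0.
Qed.

Lemma annih_ncmul2_quadratic i A B : annih i (ncmul (ncmul A P) B) =
  A [::] *: annih i (ncmul P B) + ncmul (ncmul (annih i A) P) B.
Proof.
rewrite !annih_ncmul quadratic0 ncmulDl ncmulZl.
by rewrite /ncmul big_ord1 quadratic0 mulr0 !scale0r !add0r.
Qed.

(** Induction on the degree, for all A. Once the first letter is stripped, the terms with
    [annih i A] vanish by induction, and those with the constant term of A reassemble into a
    multiple of the pairing with P B. *)
Lemma contraction_free_dotn n x A B : contraction_free x ->
  dotn n x (ncmul (ncmul A P) B) = 0.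
Proof.
have deg1 w C : (size w <= 1)%N -> ncmul P C w = 0.
  case: w => [|i [|//]] _; first by rewrite /ncmul big_ord1 quadratic0 mul0r.
  rewrite -[LHS]/(annih i (ncmul P C) [::]) annih_ncmul quadratic0 scale0r add0r.
  by rewrite annih_quadratic ncmulZl fctE ncmul_varl scaler0.
elim: n x A => [|n IHn] x A cx.
  rewrite -(dotn0r 0 x); apply: eq_dotn => // -[|//] _.
  by rewrite /ncmul !big_ord1 /= quadratic0 mulr0 mul0r.
(* P B starts in degree 2, so degree 1 is trivial; from degree 2 on this is the contraction at the
   first two letters. *)
have PB : dotn n.+1 x (ncmul P B) = 0.
  case: n {IHn} => [|n]; last first.
    have [_ c0] := (contraction_free_annih x).1 cx.
    by rewrite dotn_quad_contract c0 dotn0l.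
  rewrite -(dotn0r 1 x); apply: eq_dotn => // w sw.
  by rewrite deg1 ?sw.
have step i : dotn n (annih i x) (annih i (ncmul (ncmul A P) B)) =
    (A [::])^* * dotn n (annih i x) (annih i (ncmul P B)).
  have [/(_ i) ci _] := (contraction_free_annih x).1 cx.
  by rewrite annih_ncmul2_quadratic dotnDr dotnZr IHn ?addr0.
rewrite dotn_annih (eq_bigr _ (fun i _ => step i)) -mulr_sumr.
by rewrite -dotn_annih PB mulr0.
Qed.

Lemma dotn_monomial_quadratic n x u v : (size u + size v).+2 = n ->
  dotn n x (ncmul (ncmul (monomial R u) P) (monomial R v)) =
  \sum_(i < m) (a i)^* * x (u ++ i :: rev_ord i :: v).
Proof.
elim: u n x => [|j u IHu] n x <-.
  by rewrite ncmul_monomial0 dotn_quad_contract dotn_monomial.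
rewrite dotn_annih (bigD1 j) //= big1 ?addr0 => [|i ij].
  rewrite annih_ncmul2_quadratic /monomial scale0r add0r -/(monomial R u).
  by rewrite annih_monomial eqxx scale1r (IHu _ (annih j x)).
rewrite annih_ncmul2_quadratic /monomial scale0r add0r.
by rewrite annih_monomial (negbTE ij) scale0r !ncmul0l dotn0r.
Qed.

(** Contractions are pairings with u P v for words u and v, which lie in the ideal; conversely every
    element of the ideal is a sum of products A P B. *)
Lemma fock_partP n x : fock_part P n x <-> tensor_power n x /\ contraction_free x.
Proof.
split=> [[xn xI]|[xn cx]]; split=> //.
(* If the lengths do not match n, then x vanishes on every word of the sum. *)
- move=> u v; have [uv|uv] := eqVneq (size u + size v).+2 n; last first.
    by apply: big1 => i _; rewrite xn ?mulr0 // size_cat /= !addnS.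
  rewrite -(dotn_monomial_quadratic _ uv) xI //; split.
    exists [:: (monomial R u, monomial R v)]; split; last by rewrite big_seq1.
    by move=> AB; rewrite inE => /eqP ->; split; apply: ncpoly_monomial.
  rewrite -uv -addn2 addnAC; apply: tensor_power_ncmul.
    2: exact: tensor_power_monomial.
  apply: tensor_power_ncmul; first exact: tensor_power_monomial.
  exact: tensor_power_quadratic.
- move=> y [[s [_ ->]] _]; rewrite dotn_sumr big1 // => AB _.
  exact: contraction_free_dotn.
Qed.

End QuadraticRelation.

(** * Adjointness and first relations of the creation maps on H_n *)

Section Creation.
Variables (R : realType) (m : nat) (a : 'I_m -> R[i]).
Implicit Types (x y z : seq 'I_m -> R[i]) (u v w : seq 'I_m).
Local Notation P := (quadratic a).
Local Notation C := (creation_fun P).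

(** Dual to the inclusion of X_i I_n in I_{n+1}. *)
Lemma fock_part_annih n i x :
  fock_part P n.+1 x -> fock_part P n (annih i x).
Proof.
move=> /fock_partP[xn /contraction_free_annih[cx _]].
by apply/fock_partP; split; [exact: annih_tensor_power|exact: cx].
Qed.

Lemma fock_part_quad_contract n x : fock_part P n x -> quad_contract a x = 0.
Proof. by move=> /fock_partP[_ /contraction_free_annih[]]. Qed.

(** Against a vector of H_{n+1} the projection f_{n+1} disappears, leaving left multiplication by
    X_i, whose adjoint is [annih i]. *)
Lemma dotn_creation n i x z : fock_part P n.+1 z ->
  dotn n.+1 (C i x) z = dotn n x (annih i z).
Proof.
move=> Hz; rewrite -dotn_degree_partl degree_part_creation.
have [_ /(_ z Hz)] := fock_projP P n.+1 (ncmul (ncvar R i) (degree_part n x)).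
rewrite dotnBl => /subr0_eq <-; rewrite dotn_annih (bigD1 i) //= big1 ?addr0.
  by rewrite annih_ncmul_var eqxx scale1r dotn_degree_partl.
by move=> j ji; rewrite annih_ncmul_var (negbTE ji) scale0r dotn0l.
Qed.

(** Tested against z, this is the decomposition [dotn_annih]. *)
Lemma sum_creation_annih n x : fock_part P n.+1 x ->
  \sum_(i < m) C i (annih i x) = x.
Proof.
move=> Hx; apply: (@fock_part_ext _ _ P n.+1) => //.
  apply: fock_part_sum => i; apply: fock_part_creation.
  exact/annih_tensor_power/(fock_part_tensor Hx).
move=> z Hz; rewrite dotn_suml dotn_annih.
by apply: eq_bigr => i _; rewrite dotn_creation.
Qed.

(** Transposing the creation map gives the pairing of x with the contraction of z, which is 0. The
    outer creation map is left transposed because [creation_formula_dotn] meets the sum in this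
    form. *)
Lemma dotn_quadratic_creation n x z : fock_part P n.+2 z ->
  \sum_(i < m) a i * dotn n.+1 (C (rev_ord i) x) (annih i z) = 0.
Proof.
move=> Hz; transitivity (dotn n x (quad_contract a z)); last first.
  by rewrite (fock_part_quad_contract Hz) dotn0r.
have -> : quad_contract a z = \sum_(i < m) (a i)^* *: annih (rev_ord i) (annih i z).
  by apply/funext => v; rewrite fct_sumE.
rewrite dotn_sumr; apply: eq_bigr => i _.
by rewrite dotnZr conjCK dotn_creation //; apply: fock_part_annih.
Qed.

Lemma quadratic_creation n x : tensor_power n x ->
  \sum_(i < m) a i *: C i (C (rev_ord i) x) = 0.
Proof.
move=> xn; apply: (@fock_part_ext _ _ P n.+2).
- apply: fock_part_sum => i; apply/fock_partZ/fock_part_creation.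
  exact/fock_part_tensor/(fock_part_creation P _ xn).
- exact: fock_part0.
- move=> z Hz; rewrite dotn_suml dotn0l; apply: etrans (dotn_quadratic_creation x Hz).
  by apply: eq_bigr => i _; rewrite dotnZl dotn_creation.
Qed.

(** * The relation between annihilation and creation, for an abstract solution of the recursion for
    phi *)

Variables (phi : nat -> R[i]) (d : R[i]).
Hypothesis ha : forall i, `|a i * a (rev_ord i)| = 1.
Hypothesis sum_a : \sum_(i < m) `|a i| ^+ 2 = d.
Hypothesis phi0 : phi 0%N = 0.
Hypothesis phiS : forall n, phi n.+1 * (d - phi n) = 1.

(** The candidate T_j x, given letter by letter so that [annih i] returns the prescribed value by
    computation. *)
Definition creation_formula n j x : seq 'I_m -> R[i] :=
  fun w => if w is i :: v then
    ((i == j)%:R *: x - (a i * (a j)^* * phi n) *: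
       C (rev_ord i) (annih (rev_ord j) x)) v
  else 0.

Lemma annih_creation_formula n i j x : annih i (creation_formula n j x) =
  (i == j)%:R *: x - (a i * (a j)^* * phi n) *:
     C (rev_ord i) (annih (rev_ord j) x).
Proof. by []. Qed.

(** The correction terms add up to a multiple of the sum in [dotn_quadratic_creation], so the
    candidate pairs with H_{n+1} as X_j x does. *)
Lemma creation_formula_dotn n j x z : fock_part P n x -> fock_part P n.+1 z ->
  dotn n.+1 (creation_formula n j x) z = dotn n x (annih j z).
Proof.
move=> Hx Hz; rewrite dotn_annih.
have step i : dotn n (annih i (creation_formula n j x)) (annih i z) =
    (i == j)%:R * dotn n x (annih i z) - (a j)^* * phi n *
      (a i * dotn n (C (rev_ord i) (annih (rev_ord j) x)) (annih i z)).
  by rewrite annih_creation_formula dotnBl !dotnZl; congr (_ - _); ring.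
rewrite (eq_bigr _ (fun i _ => step i)) sumrB -mulr_sumr.
rewrite (bigD1 j) //= big1 => [|i /negbTE->]; last exact: mul0r.
(* That sum is available only when x has positive degree; in degree 0 the factor phi(0) = 0 replaces
   it. *)
rewrite eqxx mul1r addr0; case: n Hx Hz {step} => [|n] Hx Hz.
  by rewrite phi0 mulr0 mul0r subr0.
by rewrite dotn_quadratic_creation // mulr0 subr0.
Qed.

Lemma fock_part_annih_creation_formula n i j x : fock_part P n x ->
  fock_part P n (annih i (creation_formula n j x)).
Proof.
move=> Hx; rewrite annih_creation_formula addrC -scaleNr.
apply: fock_partD; last exact: fock_partZ.
case: n Hx => [|n] Hx.
  by rewrite phi0 mulr0 oppr0 scale0r; apply: fock_part0.
apply/fock_partZ/fock_part_creation.
exact/fock_part_tensor/(fock_part_annih _ Hx).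
Qed.

(** For n > 0 the contraction is conj(a_j) (1 - phi(n) (d - phi(n-1))) y with y =
    [annih (rev_ord j) x]. The assumed relation is the case i = j of [annih_creation] in lower
    degrees. *)
Lemma quad_contract_formula n j x : fock_part P n x ->
  (forall k i y, (k < n)%N -> fock_part P k y ->
     annih i (C i y) = y - (`|a i| ^+ 2 * phi k) *:
       C (rev_ord i) (annih (rev_ord i) y)) ->
  quad_contract a (creation_formula n j x) = 0.
Proof.
move=> Hx IH; pose y := annih (rev_ord j) x.
transitivity (\sum_(i < m) (a i)^* *:
  ((i == j)%:R *: annih (rev_ord i) x - (a i * (a j)^* * phi n) *:
       annih (rev_ord i) (C (rev_ord i) y))).
  by apply/funext => v; rewrite fct_sumE.
under eq_bigr do rewrite scalerBr.
rewrite sumrB (bigD1 j) //= big1 ?addr0 => [|i /negbTE->]; last first.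
  by rewrite scale0r scaler0.
rewrite eqxx scale1r -/y; case: n Hx IH => [|n] Hx IH.
  rewrite /y (annih_tensor_power0 _ (fock_part_tensor Hx)) scaler0 big1 ?subr0 //.
  by move=> i _; rewrite phi0 mulr0 scale0r scaler0.
have Hy : fock_part P n y by apply: fock_part_annih.
(* Without the factor phi this can fail in degree 0, where phi(0) = 0 makes both sides vanish. *)
have nC : phi n *: (\sum_(i < m) C i (annih i y)) = phi n *: y.
  case: n Hy {Hx IH} => [|n] Hy; first by rewrite phi0 !scale0r.
  by rewrite (sum_creation_annih Hy).
(* By [ha] the squared moduli of [a i] and [a (rev_ord i)] multiply to 1, so the coefficient of the
   last term is free of i and [nC] applies to the sum. *)
have step i : (a i)^* *: ((a i * (a j)^* * phi n.+1) *:
      annih (rev_ord i) (C (rev_ord i) y)) =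
    ((a j)^* * phi n.+1) *: (`|a i| ^+ 2 *: y - phi n *: C i (annih i y)).
  rewrite (IH n) // rev_ordK !scalerBr !scalerA; congr (_ *: _ - _ *: _).
    by rewrite normCK; ring.
  have := ha i; rewrite normrM => ha1.
  transitivity ((a j)^* * phi n.+1 * phi n * (`|a i| * `|a (rev_ord i)|) ^+ 2).
    by rewrite exprMn [`|a i| ^+ 2]normCK; ring.
  by rewrite ha1 expr1n mulr1.
rewrite (eq_bigr _ (fun i _ => step i)) -scaler_sumr sumrB -scaler_suml sum_a.
rewrite -scaler_sumr nC -scalerBl scalerA -mulrA phiS mulr1 subrr //.
Qed.

(** The candidate and [C j x] both lie in H_{n+1} and have the same pairings there, so the relation
    is read off the candidate. *)
Lemma annih_creation n i j x : fock_part P n x ->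
  annih i (C j x) = (i == j)%:R *: x -
    (a i * (a j)^* * phi n) *: C (rev_ord i) (annih (rev_ord j) x).
Proof.
elim/ltn_ind: n i j x => n IH i j x Hx.
suff -> : C j x = creation_formula n j x by exact: annih_creation_formula.
apply: (@fock_part_ext _ _ P n.+1).
- exact/fock_part_creation/(fock_part_tensor Hx).
- apply/fock_partP; split.
    move=> [//|k w] kw; rewrite -[LHS]/(annih k (creation_formula n j x) w).
    exact: (fock_part_tensor (fock_part_annih_creation_formula _ _ Hx)).
  (* Contractions past the first letter vanish because each stripped candidate lies in H_n; the one
     at the front uses the induction hypothesis. *)
  apply/contraction_free_annih; split=> [k|].
    by have /fock_partP[] := fock_part_annih_creation_formula k j Hx.
  apply: (quad_contract_formula j Hx) => k i' y kn Hy.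
  by rewrite (IH k) // eqxx scale1r normCK.
- move=> z Hz; rewrite creation_formula_dotn //; exact: dotn_creation.
Qed.

End Creation.

(* Holds for divergent u too, so no convergence of inner products is needed. *)
Lemma limn_shiftS (T : ptopologicalType) (u : nat -> T) :
  limn (fun n => u n.+1) = limn u.
Proof.
congr (get _); apply/funext => l; apply/propext.
by split; rewrite (cvg_shiftS u).
Qed.

(** * Operators on the Fock space, compared degree by degree *)

Section FockOperators.
Variables (R : realType) (m : nat) (P : seq 'I_m -> R[i]).
Local Notation C := (creation_fun P).
Implicit Types (x y z : fock P) (T U : bop P).

Lemma fock_part_val n x : fock_part P n (degree_part n x).
Proof. by have [] := fock_valP x. Qed.

(** The test vector is the degree n component of y - y', which itself belongs to the Fock space. *)
Lemma fock_inner_ext y y' :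
  (forall z, fock_inner z y = fock_inner z y') -> y = y'.
Proof.
move=> yy; apply: val_inj; apply: degree_part_ext => n.
pose z := degree_part n (fock_val (y - y')).
have Hz : fock_part P n z by apply: fock_part_val.
have zoo : z \in fock_pred P.
  apply/asboolP; split=> [k|].
    have [->|kn] := eqVneq k n; first by rewrite degree_part_id //; case: Hz.
    by rewrite (degree_part_neq kn Hz.1); apply: fock_part0.
  apply: (@le_lt_trans _ _ (series_norm2 (y - y'))).
    2: by have [] := fock_valP (y - y').
  apply: lee_nneseries => [k _ _|k _]; first by rewrite lee_fin normn2_ge0.
  rewrite lee_fin; have [->|kn] := eqVneq k n; first by rewrite normn2_degree_part.
  rewrite -(normn2_degree_part k z) (degree_part_neq kn Hz.1).
  by rewrite {1}/normn2 dotn0l normn2_ge0.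
(* The partial sums are constant as soon as they include degree n. *)
have inner t : fock_inner (Fock zoo) t = dotn n z t.
  apply: (@lim_near_cst (R[i]^o : normedModType R[i])); first exact: norm_hausdorff.
  exists n.+1 => //= N nN.
  rewrite (bigD1 (Ordinal nN)) //= big1 ?addr0 // => k kn.
  by rewrite -dotn_degree_partl (degree_part_neq kn Hz.1) dotn0l.
have zz : dotn n z z = 0.
  have -> : dotn n z z = dotn n z (fock_val (y - y')).
    by rewrite dotnC dotn_degree_partl -dotnC.
  have -> : fock_val (y - y') = fock_val y + (-1) *: fock_val y' by rewrite scaleN1r.
  by rewrite dotnDr dotnZr -!inner yy rmorphN rmorph1 mulN1r subrr.
apply: (@fock_part_ext _ _ P n); [exact: fock_part_val|exact: fock_part_val|].
move=> t Ht; apply/subr0_eq; rewrite -dotnBl.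
have -> : degree_part n (fock_val y) - degree_part n (fock_val y') = z.
  by rewrite /z -scaleN1r -degree_partZ -degree_partD scaleN1r.
rewrite -(dotn0l n t); apply: eq_dotn => // w.
exact: dotn_eq0.
Qed.

Lemma bop_sumE (I : Type) (r : seq I) (F : I -> bop P) x :
  (\sum_(i <- r) F i) x = \sum_(i <- r) F i x.
Proof. by apply: (big_morph (fun T : bop P => T x)). Qed.

Lemma fock_val_sum (I : Type) (r : seq I) (F : I -> fock P) :
  fock_val (\sum_(i <- r) F i) = \sum_(i <- r) fock_val (F i).
Proof. by apply: (big_morph (@fock_val R m P)). Qed.

Lemma bop_degree_ext T U :
  (forall x n, degree_part n (T x) = degree_part n (U x)) -> T = U.
Proof.
by move=> TU; apply: bopE => x; apply/val_inj/degree_part_ext => n; apply: TU.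
Qed.

Lemma degree_part_cseq_op n f x :
  degree_part n (cseq_op P f x) = f n *: degree_part n x.
Proof.
apply/funext => w; rewrite /degree_part !fctE /=.
by case: eqP => [->//|_]; rewrite scaler0.
Qed.

(** S_i raises the degree by one, so on S_i H_n the sequence f is read at n + 1; degree 0 is empty
    on both sides. *)
Lemma cseq_op_creation f i :
  cseq_op P f * creation P i = creation P i * cseq_op P (cseq_shift f).
Proof.
apply: bop_degree_ext => x n.
rewrite -[LHS]/(degree_part n (cseq_op P f (creation P i x))) degree_part_cseq_op.
rewrite -[RHS]/(degree_part n (C i (cseq_op P (cseq_shift f) x))).
case: n => [|n]; first by rewrite !degree_part_creation0 scaler0.
by rewrite !degree_part_creationS degree_part_cseq_op creation_funZ.
Qed.

Lemma op_norm_le T (M : R) : 0 <= M ->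
  (forall x, fock_norm (T x) <= M * fock_norm x) -> op_norm T <= M.
Proof. by move=> M0 TM; apply: ge_inf => //; exists 0 => N []. Qed.

End FockOperators.

(** * The relations in B(F_P) and the inclusion of c in T_P *)

Section ToeplitzRelations.
Variables (R : realType) (m : nat) (a : 'I_m -> R[i]).
Local Notation P := (quadratic a).
Local Notation C := (creation_fun P).
Implicit Types (x y z : fock P) (T U : bop P).

Lemma annih_fock i x : annih i x \in fock_pred P.
Proof.
have [_ xoo] := fock_valP x; apply/asboolP; split=> [n|].
  by rewrite degree_part_annih; apply/fock_part_annih/fock_part_val.
exact: le_lt_trans (series_norm2_annih i x) xoo.
Qed.

Lemma annih_bounded i : (fun x => Fock (annih_fock i x)) \in @bop_pred R m P.
Proof.
apply/asboolP; split=> [c x y|]; first exact: val_inj.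
exists 1 => x; have [_ xoo] := fock_valP x.
by apply: fock_norm_le; rewrite // expr1n mul1e; exact: series_norm2_annih.
Qed.

Definition annihilation i : bop P := Bop (annih_bounded i).

(** [annihilation i] satisfies the identity defining the adjoint, and by [fock_inner_ext] any
    operator chosen by [xget] coincides with it. *)
Lemma adjoint_creation i : adjoint (creation P i) = annihilation i.
Proof.
have adjP x y : fock_inner (creation P i x) y = fock_inner x (annihilation i y).
  (* S_i x has no component of degree 0, so the left partial sums, shifted by one, equal the right
     ones. *)
  rewrite /fock_inner -limn_shiftS; apply: (congr1 (fun u : nat -> R[i]^o => limn u)).
  apply/funext => N.
  rewrite big_ord_recl /= -dotn_degree_partl degree_part_creation0 dotn0l add0r.
  apply: eq_bigr => n _.
  rewrite /bump /= add1n -dotn_degree_partl degree_part_creationS.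
  rewrite -[LHS]conjCK -dotnC -dotn_degree_partl dotnC conjCK.
  rewrite dotn_creation ?dotn_degree_partl; last exact: fock_part_val.
  by rewrite -degree_part_annih dotnC dotn_degree_partl -dotnC.
rewrite /adjoint; case: xgetP => [T _ TP|/(_ (annihilation i))//].
apply: bopE => y; apply: fock_inner_ext => z.
by rewrite -TP adjP.
Qed.

Lemma sum_creation_adjoint :
  \sum_(i < m) creation P i * adjoint (creation P i) = 1 - cseq_op P (cseq_proj R 0).
Proof.
apply: bop_degree_ext => x n; rewrite bop_sumE fock_val_sum degree_part_sum.
rewrite (_ : degree_part n ((1 - _ : bop P) x) =
  degree_part n (fock_val x + (-1) *: fock_val (cseq_op P (cseq_proj R 0) x))); last first.
  by rewrite scaleN1r.
rewrite degree_partD degree_partZ degree_part_cseq_op.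
have step i : degree_part n ((creation P i * adjoint (creation P i)) x) =
    degree_part n (C i (annih i x)) by rewrite adjoint_creation.
rewrite (eq_bigr _ (fun i _ => step i)); case: n step => [|n] _.
  rewrite big1 => [|i _]; last exact: degree_part_creation0.
  by rewrite /= scale1r scaleN1r subrr.
rewrite /= scale0r scaler0 addr0 -[RHS](sum_creation_annih (fock_part_val n.+1 x)).
by apply: eq_bigr => i _; rewrite degree_part_creationS degree_part_annih.
Qed.

Lemma quadratic_creation_op :
  \sum_(i < m) a i *: (creation P i * creation P (rev_ord i)) = 0.
Proof.
apply: bop_degree_ext => x n; rewrite bop_sumE fock_val_sum degree_part_sum.
rewrite (_ : fock_val ((0 : bop P) x) = 0) //.
rewrite [RHS](_ : _ = 0); last by apply/funext => w; rewrite /degree_part if_same.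
have step i : degree_part n ((a i *: (creation P i * creation P (rev_ord i))) x) =
    a i *: degree_part n (C i (C (rev_ord i) x)) by rewrite -degree_partZ.
(* Two creation maps raise the degree by 2, so degrees 0 and 1 are empty. *)
rewrite (eq_bigr _ (fun i _ => step i)); case: n {step} => [|[|n]].
- by apply: big1 => i _; rewrite degree_part_creation0 scaler0.
- apply: big1 => i _.
  by rewrite degree_part_creationS degree_part_creation0 creation_fun0 scaler0.
- under eq_bigr do rewrite !degree_part_creationS.
  exact/quadratic_creation/tensor_power_degree_part.
Qed.

(** Lifts a relation known on every H_n to B(F_P), with a general f in place of phi. *)
Lemma adjoint_creation_relation (f : cseq R) i j :
  (forall n (x : seq 'I_m -> R[i]), fock_part P n x -> annih i (C j x) =
     (i == j)%:R *: x - (a i * (a j)^* * f n) *: C (rev_ord i) (annih (rev_ord j) x)) ->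
  adjoint (creation P i) * creation P j +
    (a i * (a j)^*) *: (cseq_op P f * creation P (rev_ord i) *
                        adjoint (creation P (rev_ord j))) = (i == j)%:R.
Proof.
move=> rel; rewrite !adjoint_creation; apply: bop_degree_ext => x n.
rewrite (_ : fock_val ((_%:R : bop P) x) = (i == j)%:R *: fock_val x); last first.
  by case: eqP => _; rewrite ?scale1r ?scale0r.
rewrite -[LHS]/(degree_part n (annih i (C j x) + (a i * (a j)^*) *:
  fock_val (cseq_op P f (creation P (rev_ord i) (annihilation (rev_ord j) x))))).
rewrite degree_partD !degree_partZ degree_part_annih degree_part_cseq_op.
rewrite degree_part_creationS (rel n); last exact: fock_part_val.
rewrite scalerA.
rewrite -[degree_part n (creation _ _ _)]/(
  degree_part n (C (rev_ord i) (annih (rev_ord j) x))).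
rewrite [X in _ + _ *: X](_ : _ =
  C (rev_ord i) (annih (rev_ord j) (degree_part n x))) ?subrK //.
case: n => [|n]; last by rewrite degree_part_creationS degree_part_annih.
rewrite degree_part_creation0 annih_tensor_power0 ?creation_fun0 //.
exact: tensor_power_degree_part.
Qed.

(** Every C*-subalgebra in question contains all e_n, and combinations of 1 and finitely many e_n
    approximate f in norm. *)
Lemma cseq_op_toeplitz f : toeplitz P (cseq_op P f).
Proof.
move=> A [[A1 Alin AM Aadj Acl] AS].
have AC i : A (creation P i) by apply: AS; exists i.
have A0 : A 0 by rewrite -(addNr 1) -scaleN1r; apply: Alin.
have AZ c T : A T -> A (c *: T).
  by move=> AT; rewrite -[_ *: _]addr0; exact: Alin.
have AD T U : A T -> A U -> A (T + U).
  by move=> AT AU; rewrite -[T]scale1r; apply: Alin.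
have Asum (I : Type) (r : seq I) (F : I -> bop P) :
    (forall i, A (F i)) -> A (\sum_(i <- r) F i).
  by move=> AF; elim/big_ind: _ => //.
have Ae n : A (cseq_op P (cseq_proj R n)).
  elim: n => [|n IHn].
    have -> : cseq_op P (cseq_proj R 0) =
        (-1) *: (\sum_(i < m) creation P i * adjoint (creation P i)) + 1.
      by rewrite sum_creation_adjoint scaleN1r opprB subrK.
    by apply: (Alin _ _ _ _ A1); apply: Asum => i; apply: AM => //; apply: Aadj.
  have -> : cseq_op P (cseq_proj R n.+1) = \sum_(i < m)
      creation P i * cseq_op P (cseq_proj R n) * adjoint (creation P i).
    (* Since gamma(e_{n+1}) = e_n, S_i e_n = e_{n+1} S_i. *)
    have step i : creation P i * cseq_op P (cseq_proj R n) * adjoint (creation P i) =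
        cseq_op P (cseq_proj R n.+1) * (creation P i * adjoint (creation P i)).
      rewrite mulrA cseq_op_creation; congr (_ * _ * _).
      by apply: bopE => x; apply: val_inj; apply/funext => w; rewrite /= eqSS.
    rewrite (eq_bigr _ (fun i _ => step i)) -mulr_sumr sum_creation_adjoint.
    rewrite mulrBr mulr1 (_ : _ * _ = 0) ?subr0 //.
    apply: bopE => x; apply: val_inj; apply/funext => -[|k w] /=.
      by rewrite mul0r.
    by rewrite mul0r mulr0.
  by apply: Asum => i; exact: AM (AM _ _ (AC i) IHn) (Aadj _ (AC i)).
have /cvg_ex[l fl] := @cseqP _ f.
apply: Acl => e e0.
have e2 : 0 < (e / 2)%:C%C :> R[i] by rewrite ltcR divr_gt0.
move/cvgrPdist_lt : fl => /(_ _ e2)[N _ fN].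
(* U agrees with f in degrees below N and is the limit l from N on. *)
pose U : bop P := (l : R[i]) *: (1 : bop P) +
  (\sum_(n < N) (f n - l) *: cseq_op P (cseq_proj R n) : bop P).
exists U.
  by rewrite /U; apply: AD; [exact: AZ|apply: Asum => n; exact: AZ].
apply: (@le_lt_trans _ _ (e / 2)); last by rewrite ltr_pdivrMr // ltr_pMr // ltr1n.
apply: op_norm_le => [|x]; first by rewrite ltW // divr_gt0.
have [_ xoo] := fock_valP x; apply: fock_norm_le => //.
  by rewrite ltW // divr_gt0.
(* The error f - U is multiplication by [u], so a pointwise bound on [u] bounds its norm. *)
pose u (w : seq 'I_m) : R[i] := f (size w) -
  (l + \sum_(n < N) (f n - l) * (size w == n)%:R).
have -> : fock_val ((cseq_op P f - U) x) = (fun w => u w * x w).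
  apply/funext => w; transitivity (f (size w) * x w - (l * x w +
    fock_val ((\sum_(n < N) (f n - l) *: cseq_op P (cseq_proj R n)) x) w)) => //.
  rewrite bop_sumE fock_val_sum fct_sumE /u mulrBl mulrDl mulr_suml.
  by congr (_ - (_ + _)); apply: eq_bigr => n _; rewrite -mulrA.
apply: series_norm2_scale => w; rewrite /u; have [wN|wN] := ltnP (size w) N.
  rewrite (bigD1 (Ordinal wN)) //= eqxx mulr1 big1 ?addr0; last first.
    by move=> n nw; rewrite eq_sym (negbTE (_ : nat_of_ord n != size w)) ?mulr0.
  by rewrite subrKC subrr normr0 ler0c ltW // divr_gt0.
rewrite big1 ?addr0 => [|n _]; last first.
  by rewrite gtn_eqF ?mulr0 // (leq_trans (ltn_ord n)).
by rewrite distrC ltW //; apply: fN.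
Qed.

End ToeplitzRelations.

(** * Recursions for quantum integers and their ratios *)

Section QuantumIntegers.
Variables (R : realType) (q : R).
Hypothesis hq : 0 < q <= 1.

Lemma subrV_neq0 (x : R) : 0 < x < 1 -> x - x^-1 != 0.
Proof.
move=> /andP[x0 x1]; rewrite subr_eq0; apply/eqP => xV.
have : x * x < 1 * 1 by rewrite ltr_pM // ltW.
by rewrite {2}xV divff ?gt_eqF // mul1r ltxx.
Qed.

Lemma qintS_neq0 n : qint q n.+1 != 0.
Proof.
rewrite /qint; case: (q =P 1) => [_|/eqP qN1]; first by rewrite pnatr_eq0.
have /andP[q0 q1] := hq; have q1' : q < 1 by rewrite lt_neqAle qN1.
rewrite mulf_neq0 ?invr_eq0 ?subrV_neq0 ?q0 ?exprn_gt0 //=.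
by rewrite exprn_ilt1 // ltW.
Qed.

Lemma qint_rec n : qint q n.+2 = (q + q^-1) * qint q n.+1 - qint q n.
Proof.
rewrite /qint; case: (q =P 1) => [->|/eqP qN1].
  by rewrite invr1 -(natr1 n.+1) -(natr1 n); ring.
have /andP[q0 q1] := hq; have qx : q != 0 by rewrite gt_eqF.
have d : q - q^-1 != 0 by rewrite subrV_neq0 // q0 lt_neqAle qN1.
apply: (mulIf d); rewrite [LHS]divfK // [RHS]mulrBl -mulrA !divfK // !exprS; field.
by rewrite qx expf_neq0.
Qed.

(** The recursion [qint_rec] divided by [n+2]_q; it supplies [phiS] with d = q + q^-1. *)
Lemma qint_ratioS n :
  qint q n.+1 / qint q n.+2 * (q + q^-1 - qint q n / qint q n.+1) = 1.
Proof.
have n1 := qintS_neq0 n; have n2 := qintS_neq0 n.+1.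
apply: (mulIf n2); rewrite mul1r mulrAC divfK // mulrBr mulrC [_ * (_ / _)]mulrC.
by rewrite divfK // -qint_rec.
Qed.

End QuantumIntegers.

Theorem proposition1p7 (R : realType) (m : nat) (hm : (2 <= m)%N)
    (a : 'I_m -> R[i]) (ha : forall i, `|a i * a (rev_ord i)| = 1)
    (q : R) (hq : 0 < q <= 1)
    (haq : \sum_(i < m) `|a i| ^+ 2 = (q + q^-1)%:C%C) :
  let P := quadratic a in
  let S := creation P in
  let phi := cseq_op P (cseq_phi hq) in
  [/\ (forall f : cseq R, toeplitz P (cseq_op P f)),
      (forall (f : cseq R) (i : 'I_m),
         cseq_op P f * S i = S i * cseq_op P (cseq_shift f)),
      \sum_(i < m) S i * adjoint (S i) = 1 - cseq_op P (cseq_proj R 0),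
      \sum_(i < m) a i *: (S i * S (rev_ord i)) = 0 &
      forall i j : 'I_m,
        adjoint (S i) * S j
        + (a i * (a j)^*) *: (phi * S (rev_ord i) * adjoint (S (rev_ord j)))
        = (i == j)%:R].
Proof.
split.
- exact: cseq_op_toeplitz.
- exact: cseq_op_creation.
- exact: sum_creation_adjoint.
- exact: quadratic_creation_op.
move=> i j; apply: adjoint_creation_relation => n x Hx.
(* The two conditions left are phi(0) = 0, from [0]_q = 0, and the recursion for phi. *)
apply: (annih_creation ha haq) => //= [|k].
  by rewrite /qint expr0 invr1 subrr mul0r if_same mul0r.
by rewrite -rmorphB -rmorphM qint_ratioS.
Qed.
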